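(* Let $p$ be a prime, $r\ge 1$ an integer, and let $n$ be an integer with $2\le n\le p$. Then the group cohomology with trivial coefficients satisfies \[ H^{r(2p-3)}(GL_n(\mathbb{F}_{p^r});\mathbb{F}_p)\neq 0. \]
   Context: $\mathbb{F}_{p^r}$ is the finite field with $p^r$ elements, and $GL_n(\mathbb{F}_{p^r})$ is regarded as a finite (discrete) group. *)

(* Defs.v *)
From HB Require Import structures.
From mathcomp Require Import all_boot all_order all_algebra all_fingroup.
From mathcomp Require Import zify.

Set Implicit Arguments.
Unset Strict Implicit.
Unset Printing Implicit Defensive.

Import GRing.Theory.

Local Open Scope ring_scope.

(* Cohomology of a finite group gT with coefficients in a finite abelian group *)
(* A carrying the trivial action, computed by the inhomogeneous bar complex:   *)
(* C^m is the group of all functions gT^m -> A, and                            *)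
(*   (d f)(g_1, ..., g_(m+1)) = f(g_2, ..., g_(m+1))                           *)
(*     + \sum_(1 <= i <= m) (-1)^i f(g_1, ..., g_i g_(i+1), ..., g_(m+1))      *)
(*     + (-1)^(m+1) f(g_1, ..., g_m).                                          *)

Definition cochain (gT : finGroupType) (A : finZmodType) (m : nat) : Type :=
  {ffun {ffun 'I_m -> gT} -> A}.

HB.instance Definition _ gT A m := Finite.on (cochain gT A m).
HB.instance Definition _ gT A m := GRing.Zmodule.on (cochain gT A m).
HB.instance Definition _ gT A m := [finGroupMixin of cochain gT A m for +%R].

(* With g = (g_1, ..., g_(m+1)), the faces of index 0 and m+1 drop g_1 and     *)
(* g_(m+1) respectively, and the face of index 1 <= i <= m multiplies g_i by   *)
(* g_(i+1).  Position k : 'I_m stands for the (k+1)-st entry, so that          *)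
(* g (lift ord_max k) is g_(k+1) and g (lift ord0 k) is g_(k+2).               *)
Definition bar_face (gT : finGroupType) (m : nat) (i : 'I_m.+2)
    (g : {ffun 'I_m.+1 -> gT}) : {ffun 'I_m -> gT} :=
  [ffun k : 'I_m =>
     if (k.+1 < i)%N then g (lift ord_max k)
     else if k.+1 == i then (g (lift ord_max k) * g (lift ord0 k))%g
     else g (lift ord0 k)].

Definition bar_diff (gT : finGroupType) (A : finZmodType) (m : nat)
    (f : cochain gT A m) : cochain gT A m.+1 :=
  [ffun g : {ffun 'I_m.+1 -> gT} =>
     \sum_(i < m.+2) (if odd i then - f (bar_face i g) else f (bar_face i g))].

Lemma bar_diffM (gT : finGroupType) (A : finZmodType) (m : nat) :
  {in setT &, {morph @bar_diff gT A m : f1 f2 / (f1 * f2)%g}}.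
Proof.
move=> f1 f2 _ _; apply/ffunP=> g.
rewrite /bar_diff [in RHS]/mulg /= !ffunE -big_split.
by apply: eq_bigr => i _ /=; rewrite ffunE; case: ifP; rewrite // opprD.
Qed.

Canonical bar_diff_morphism (gT : finGroupType) (A : finZmodType) (m : nat) :=
  Morphism (@bar_diffM gT A m).

Definition cocycles (gT : finGroupType) (A : finZmodType) (m : nat) :
    {group cochain gT A m} :=
  ('ker (@bar_diff gT A m))%G.

Definition coboundaries (gT : finGroupType) (A : finZmodType) (m : nat) :
    {group cochain gT A m} :=
  match m with
  | 0 => 1%G
  | m'.+1 => (@bar_diff gT A m' @* setT)%G
  end.

Lemma bar_face_comm (gT : finGroupType) (m : nat)
    (i : 'I_m.+2) (j : 'I_m.+3) (i' : 'I_m.+2) (j' : 'I_m.+3)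
    (g : {ffun 'I_m.+2 -> gT}) :
  (i < j)%N -> j' = i :> nat -> i'.+1 = j ->
  bar_face i (bar_face j g) = bar_face i' (bar_face j' g).
Proof.
move=> ltij ej' ei'; apply/ffunP=> k.
pose h n := g (inord n).
have gE (x : 'I_m.+2) : g x = h x by rewrite /h inord_val.
rewrite !ffunE !gE /= /bump !leq0n !add1n; have ltk := ltn_ord k.
have -> : (m <= k)%N = false by lia.
have -> : (m.+1 <= k)%N = false by lia.
have -> : (m.+1 <= k.+1)%N = false by lia.
rewrite !add0n ej' -ei'; move: ltij; rewrite -ei' => ltij.
by repeat (case: ifP => ?); rewrite ?mulgA //; exfalso; lia.
Qed.

Lemma bar_diffK (gT : finGroupType) (A : finZmodType) (m : nat)
    (f : cochain gT A m) :
  bar_diff (bar_diff f) = 0.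
Proof.
apply/ffunP=> g; rewrite !ffunE.
pose t (i j : nat) (x : A) := if odd (i + j) then - x else x.
pose F (q : 'I_m.+2 * 'I_m.+3) := t q.1 q.2 (f (bar_face q.1 (bar_face q.2 g))).
transitivity (\sum_q F q).
  rewrite -(pair_bigA _ (fun i j => F (i, j))) exchange_big /=.
  apply: eq_bigr => j _; rewrite ffunE; case: ifP => oj.
    rewrite -sumrN; apply: eq_bigr => i _; rewrite /F /t /= oddD oj addbT.
    by case: (odd i); rewrite ?opprK.
  by apply: eq_bigr => i _; rewrite /F /t /= oddD oj addbF.
rewrite (bigID (fun q : 'I_m.+2 * 'I_m.+3 => q.1 < q.2)%N) /=.
pose u (q : 'I_m.+2 * 'I_m.+3) : 'I_m.+2 * 'I_m.+3 := (inord q.2.-1, inord q.1).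
pose v (q : 'I_m.+2 * 'I_m.+3) : 'I_m.+2 * 'I_m.+3 := (inord q.2, inord q.1.+1).
apply/eqP; rewrite addr_eq0; apply/eqP.
rewrite (reindex_onto v u) /=; last first.
  case=> i j /= ltij; rewrite /u /v /=; have ltj := ltn_ord j.
  have lti := ltn_ord i.
  congr (_, _); apply: val_inj; rewrite /= !inordK //; lia.
rewrite -sumrN; apply: eq_big => [[i j]|[i j]] /=.
  have ltj := ltn_ord j; have lti := ltn_ord i.
  rewrite /u /v /= [inord i.+1 : nat]inordK //.
  rewrite -leqNgt; apply/andP/idP => [[lt_j /eqP[_ /(congr1 val) /= ej]]|leji].
    by rewrite inordK in ej; [rewrite ej in lt_j|apply: leq_trans (ltn_ord _) _].
  have hj : (j < m.+2)%N by lia.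
  by split; [rewrite inordK|apply/eqP; congr (_, _); apply: val_inj; rewrite /= !inordK].
case/andP=> ltv /eqP[_ /(congr1 val) /= ej]; rewrite /F /t /=.
have ltj := ltn_ord j; have lti := ltn_ord i.
rewrite inordK in ej; last by apply: leq_trans (ltn_ord _) _.
have ei : (inord i.+1 : 'I_m.+3) = i.+1 :> nat by rewrite inordK.
rewrite (@bar_face_comm _ _ _ _ i j) ?ei ?ej //; last by rewrite ej ei in ltv.
rewrite addnS oddS addnC.
by case: (odd _); rewrite ?opprK.
Qed.

Lemma coboundaries_sub_cocycles (gT : finGroupType) (A : finZmodType) (m : nat) :
  coboundaries gT A m \subset cocycles gT A m.
Proof.
case: m => [|m]; first exact: sub1G.
apply/subsetP=> _ /morphimP[f _ _ ->].
by apply/kerP; [rewrite inE|apply: bar_diffK].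
Qed.

(* H^m = Z^m / B^m as a quotient of finite groups.  The group law is written   *)
(* multiplicatively but is pointwise addition of cochains, so that the zero    *)
(* cohomology group is the trivial group 1%g.                                  *)
Definition cohomology (gT : finGroupType) (A : finZmodType) (m : nat) :
    {group coset_of (coboundaries gT A m)} :=
  (cocycles gT A m / coboundaries gT A m)%G.

(* Main.v *)
From HB Require Import structures.
Require Import Defs.
From mathcomp Require Import all_boot all_order all_algebra all_fingroup.
From mathcomp Require Import all_field.
From mathcomp Require Import zify ring.

(* Let q = p^r. A point of X is a pair of a nonzero row vector v and a class   *)
(* u modulo v; GL_n acts on X, and comparing u with its normalised             *)
(* representative gives a 1-cocycle c on this action with values in (F, +).    *)
(* Summing the pullbacks of a cocycle w of F along c over all x in X gives a   *)
(* cocycle of GL_n: the transfer of w from the stabilisers.  Restrict it to F, *)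
(* acting on polynomials of degree < n by P(t) |-> P(t + a).  As n <= p, only  *)
(* constants are invariant under a translation with a != 0, so that each point *)
(* of X is fixed by F or has a free orbit.  Free orbits contribute nothing once *)
(* c is changed by a coboundary, and the fixed points (l, m t), l != 0,        *)
(* contribute the pullbacks of w under multiplication by m / l.                *)
(*   For w take phi o omega, where phi : F -> F_p is additive and omega is the *)
(* cup product of x_i and y_i^(p-2) over i < r, with x_i(a) = a^(p^i) and y_i  *)
(* the p^i-th power of the class ((a + b)^p - a^p - b^p) / p.  It has degree   *)
(* r(2p - 3) and is homogeneous of weight                                      *)
(*   (1 + p(p - 2)) (1 + p + ... + p^(r-1)) = (p - 1)(q - 1),                  *)
(* so that the sum over the fixed points is (q - 1)^2 w = w.                   *)
(*   Finally omega is not a coboundary on F: contracting it with suitable      *)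
(* elements of F removes the x_i, by the linear independence of the Frobenius  *)
(* powers, and what is left is nonzero on the cycle                            *)
(* \sum_k [k_1|1|k_2|1|...] of the prime field.                                *)

Set Implicit Arguments.
Unset Strict Implicit.
Unset Printing Implicit Defensive.

Import GRing.Theory Num.Theory.
Local Open Scope ring_scope.

(** * The bar complex on sequences *)

(** The class is detected on the additive group of F, embedded in GL_n by [translationGL]. A cocycle
    of F that vanishes on zero tuples transfers to GL_n along the flags, and [exists_transfer]
    computes the restriction of the result to F as a sum over fixed flags only; [fixset_flags] lists
    these. On a homogeneous cocycle the sum is multiplication by a sum of powers of m / l, which is
    1 by [sum_ratios] when the weight is a positive multiple of q - 1. By [omega_scale], [omega] has
    such a weight, so that phi o omega is a restriction from GL_n.

    A coboundary on GL_n restricts to a coboundary on F, and every [slant] kills those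
    ([slant_bar_d]). But [slant_omega] finds a slant with nonzero value on [omega], and phi is
    chosen afterwards so as not to kill this value. [cohomology_neq1] carries the conclusion over to
    the bar complex of finite functions. *)

Section SeqBar.

Variables (T : Type) (op : T -> T -> T).

(* [bar_tail f a s] is the negative of the part of the differential of [f] at *)
(* [a :: s] given by the faces of positive index.                              *)
Fixpoint bar_tail (A : comNzRingType) (f : seq T -> A) (a : T) (s : seq T) : A :=
  if s is b :: s' then f (op a b :: s') - bar_tail (fun t => f (a :: t)) b s'
  else f [::].

Definition bar_d (A : comNzRingType) (f : seq T -> A) (s : seq T) : A :=
  if s is a :: s' then f s' - bar_tail f a s' else 0.

(* The alternating sum of the insertions of [x] at all positions: an interior *)
(* product, which anticommutes with the differential when [x] is central.      *)
Fixpoint contract (A : comNzRingType) (x : T) (f : seq T -> A) (s : seq T) : A :=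
  f (x :: s) - (if s is a :: s' then contract x (fun t => f (a :: t)) s' else 0).

Lemma eq_contract (A : comNzRingType) x (f g : seq T -> A) s :
  (forall t, size t = (size s).+1 -> f t = g t) ->
  contract x f s = contract x g s.
Proof.
elim: s f g => [|a s IHs] f g eqfg /=; rewrite eqfg //; congr (_ - _).
by apply: IHs => t szt; rewrite eqfg //= szt.
Qed.

Lemma raddf_bar_tail (A B : comNzRingType) (phi : {additive A -> B}) f a s :
  phi (bar_tail f a s) = bar_tail (fun t => phi (f t)) a s.
Proof. by elim: s f a => [|b s IHs] f a //=; rewrite raddfB IHs. Qed.

Lemma raddf_contract (A B : comNzRingType) (phi : {additive A -> B}) x f s :
  phi (contract x f s) = contract x (fun t => phi (f t)) s.
Proof.
by elim: s f => [|a s IHs] f /=; rewrite raddfB ?raddf0 // IHs.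
Qed.

Lemma bar_tailB (A : comNzRingType) (f g : seq T -> A) a s :
  bar_tail (fun t => f t - g t) a s = bar_tail f a s - bar_tail g a s.
Proof.
by elim: s f g a => [|b s IHs] f g a //=; rewrite IHs; ring.
Qed.

Lemma contractB (A : comNzRingType) x (f g : seq T -> A) s :
  contract x (fun t => f t - g t) s = contract x f s - contract x g s.
Proof.
elim: s f g => [|a s IHs] f g /=; first by rewrite !subr0.
by rewrite IHs; ring.
Qed.

Lemma bar_tail_sum (A : comNzRingType) (I : Type) (r : seq I) (P : pred I)
    (f : I -> seq T -> A) a s :
  bar_tail (fun t => \sum_(i <- r | P i) f i t) a s =
  \sum_(i <- r | P i) bar_tail (f i) a s.
Proof.
by elim: s f a => [|b s IHs] f a //=; rewrite (IHs (fun i t => f i (a :: t))) sumrB.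
Qed.

Lemma contract_sum (A : comNzRingType) x (I : Type) (r : seq I) (P : pred I)
    (f : I -> seq T -> A) s :
  contract x (fun t => \sum_(i <- r | P i) f i t) s =
  \sum_(i <- r | P i) contract x (f i) s.
Proof.
elim: s f => [|a s IHs] f /=; rewrite sumrB; first by rewrite big1_eq.
by rewrite (IHs (fun i t => f i (a :: t))).
Qed.

Lemma bar_tail0 (A : comNzRingType) a s : bar_tail (fun _ => 0 : A) a s = 0.
Proof. by elim: s a => [|b s IHs] a //=; rewrite IHs subr0. Qed.

Lemma contract0 (A : comNzRingType) x s : contract x (fun _ => 0 : A) s = 0.
Proof. by elim: s => [|b s IHs] //=; rewrite ?IHs subr0. Qed.

(** Faces merging the inserted [x] with its left or right neighbour cancel in pairs, as [x] is
    central. The correction terms come from the insertion before [a], which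
    [contract x (bar_tail f a)] does not see, and from the last face, which drops an [x] inserted at
    the end. *)
Lemma contract_bar_tail (A : comNzRingType) x (f : seq T -> A) a s :
    (forall b, op x b = op b x) ->
  bar_tail (contract x f) a s =
  f (a :: s) - f (op x a :: s) + bar_tail (fun t => f (x :: t)) a s
    + contract x (bar_tail f a) s.
Proof.
move=> opC; elim: s f a => [|b s IHs] f a /=; first by rewrite opC; ring.
rewrite (contractB x (fun t => f (op a b :: t))).
rewrite (bar_tailB (fun t => f (x :: a :: t))) IHs (opC a).
ring.
Qed.


Lemma contract_bar_d (A : comNzRingType) x (f : seq T -> A) s :
    (forall b, op x b = op b x) ->
  contract x (bar_d f) s = - bar_d (contract x f) s.
Proof.
move=> opC; case: s => [|a s] /=; first by ring.
by rewrite (contractB x f) contract_bar_tail //; ring.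
Qed.

Definition cup1 (A : comNzRingType) (u : T -> A) (v : seq T -> A) (s : seq T) : A :=
  if s is a :: s' then u a * v s' else 0.

Definition cup2 (A : comNzRingType) (u : T -> T -> A) (v : seq T -> A)
    (s : seq T) : A :=
  if s is a :: b :: s' then u a b * v s' else 0.

Definition cup0 (A : comNzRingType) (s : seq T) : A :=
  if s is [::] then 1 else 0.

Lemma bar_tailZ (A : comNzRingType) (c : A) (f : seq T -> A) a s :
  bar_tail (fun t => c * f t) a s = c * bar_tail f a s.
Proof. by elim: s f a => [|b s IHs] f a //=; rewrite IHs mulrBr. Qed.

Lemma contractZ (A : comNzRingType) x (c : A) (f : seq T -> A) s :
  contract x (fun t => c * f t) s = c * contract x f s.
Proof. by elim: s f => [|b s IHs] f //=; rewrite ?IHs; ring. Qed.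

Lemma bar_d_cup0 (A : comNzRingType) s : bar_d (@cup0 A) s = 0.
Proof.
case: s => [|a [|b s]] //=; first by ring.
by rewrite bar_tail0 !subr0.
Qed.

Lemma bar_d_cup1 (A : comNzRingType) (u : T -> A) v s :
    (forall a b, u (op a b) = u a + u b) -> (forall t, bar_d v t = 0) ->
  bar_d (cup1 u v) s = 0.
Proof.
move=> uD v0; case: s => [|a [|b s]] //=; first by ring.
have := v0 (b :: s) => /= /eqP; rewrite subr_eq0 => /eqP vE.
by rewrite bar_tailZ -vE uD; ring.
Qed.

Lemma bar_d_cup2 (A : comNzRingType) (u : T -> T -> A) v s :
    (forall a b c, u b c - u (op a b) c + u a (op b c) - u a b = 0) ->
    (forall t, bar_d v t = 0) ->
  bar_d (cup2 u v) s = 0.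
Proof.
move=> uD v0; case: s => [|a [|b [|c s]]] //=; try by ring.
have := v0 (c :: s) => /= /eqP; rewrite subr_eq0 => /eqP vE.
rewrite bar_tailZ -vE; transitivity (0 * v s); last by ring.
by rewrite -(uD a b c); ring.
Qed.

Lemma contract_cup0 (A : comNzRingType) x s : contract x (@cup0 A) s = 0.
Proof. by case: s => [|a s] /=; rewrite ?contract0; ring. Qed.

Lemma contract_cup1 (A : comNzRingType) x (u : T -> A) v s :
  contract x (cup1 u v) s = u x * v s - cup1 u (contract x v) s.
Proof. by case: s => [|a s] /=; rewrite ?contractZ; ring. Qed.

(** The insertions of [x] into the first two places carry opposite signs and cancel by symmetry of
    [u]. *)
Lemma contract_cup2 (A : comNzRingType) x (u : T -> T -> A) v s :
  (forall a, u x a = u a x) ->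
  contract x (cup2 u v) s = cup2 u (contract x v) s.
Proof.
by move=> uC; case: s => [|a [|b s]] /=; rewrite ?contractZ ?uC; ring.
Qed.

End SeqBar.

Lemma bar_tail_map (T U : Type) (opT : T -> T -> T) (opU : U -> U -> U)
    (A : comNzRingType) (h : T -> U) (f : seq U -> A) a s :
    (forall b c, h (opT b c) = opU (h b) (h c)) ->
  bar_tail opT (fun t => f (map h t)) a s = bar_tail opU f (h a) (map h s).
Proof.
move=> hD; elim: s f a => [|b s IHs] f a //=.
by rewrite hD (IHs (fun t => f (h a :: t))).
Qed.

Lemma bar_d_map (T U : Type) (opT : T -> T -> T) (opU : U -> U -> U)
    (A : comNzRingType) (h : T -> U) (f : seq U -> A) s :
    (forall b c, h (opT b c) = opU (h b) (h c)) ->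
  bar_d opT (fun t => f (map h t)) s = bar_d opU f (map h s).
Proof. by move=> hD; case: s => //= a s; rewrite (bar_tail_map _ _ _ hD). Qed.

(** * Evaluation on products of cycles *)

Section Periodic.

Variables (T : zmodType) (t : T) (p : nat) (A : comNzRingType).
Hypotheses (p_gt0 : (0 < p)%N) (tp0 : t *+ p = 0) (Ap0 : p%:R = 0 :> A).

Lemma sum_mulrnS (g : T -> A) :
  \sum_(k < p) g (t *+ k + t) = \sum_(k < p) g (t *+ k).
Proof.
case: p p_gt0 tp0 => // p' _ tp'0; rewrite big_ord_recr [RHS]big_ord_recl /=.
rewrite -mulrSr tp'0 mulr0n addrC; congr (_ + _).
by apply: eq_bigr => k _; rewrite /bump /= add1n mulrSr.
Qed.

(* Evaluation at [\sum_k [k_1 t|t|k_2 t|t|...|k_m t|t]], the standard 2m-cycle  *)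
(* of the cyclic group generated by [t].                                       *)
Fixpoint cyc_eval (m : nat) (f : seq T -> A) : A :=
  if m is m'.+1 then \sum_(k < p) cyc_eval m' (fun s => f (t *+ k :: t :: s))
  else f [::].

Lemma eq_cyc_eval m f g :
  (forall s, size s = m.*2 -> f s = g s) -> cyc_eval m f = cyc_eval m g.
Proof.
elim: m f g => [|m IHm] f g eqfg /=; first exact: eqfg.
by apply: eq_bigr => k _; apply: IHm => s szs; rewrite eqfg //= szs doubleS.
Qed.

Lemma cyc_eval_sum m (I : Type) (r : seq I) (P : pred I) (f : I -> seq T -> A) :
  cyc_eval m (fun s => \sum_(i <- r | P i) f i s) =
  \sum_(i <- r | P i) cyc_eval m (f i).
Proof.
elim: m f => [|m IHm] f //=; rewrite exchange_big; apply: eq_bigr => k _.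
exact: (IHm (fun i s => f i (t *+ k :: t :: s))).
Qed.

Lemma cyc_evalB m (f g : seq T -> A) :
  cyc_eval m (fun s => f s - g s) = cyc_eval m f - cyc_eval m g.
Proof.
elim: m f g => [|m IHm] f g //=; rewrite -sumrB; apply: eq_bigr => k _.
exact: (IHm (fun s => f (t *+ k :: t :: s))).
Qed.

Lemma cyc_evalZ m c (f : seq T -> A) :
  cyc_eval m (fun s => c * f s) = c * cyc_eval m f.
Proof.
elim: m f => [|m IHm] f //=; rewrite mulr_sumr; apply: eq_bigr => k _.
exact: (IHm (fun s => f (t *+ k :: t :: s))).
Qed.

(** Adding [t] permutes its multiples cyclically, so the terms with [t *+ k + t] and with [t *+ k]
    have the same sum over [k]. *)
Lemma cyc_eval_bar_tail m (f : seq T -> A) :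
  cyc_eval m (bar_tail +%R f t) = cyc_eval m f.
Proof.
elim: m f => [|m IHm] f //=.
pose g k := cyc_eval m (fun s => f (k :: t :: s)).
pose h k := cyc_eval m (fun s => f (t :: k :: s)).
transitivity (\sum_(k < p) (g (t *+ k + t) - (h (t *+ k + t) - h (t *+ k)))).
  apply: eq_bigr => k _; rewrite cyc_evalB cyc_evalB [t + _]addrC.
  by rewrite (IHm (fun s => f [:: t, t *+ k & s])).
rewrite !sumrB (sum_mulrnS g) (sum_mulrnS h) subrr subr0.
by apply: eq_bigr.
Qed.

(** The first face does not depend on [k] and is counted [p] times, hence vanishes in [A]; the other
    faces cancel by the cyclic shift. *)
Lemma cyc_eval_bar_d m (f : seq T -> A) : cyc_eval m (bar_d +%R f) = 0.
Proof.
case: m => [|m] //=.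
pose c := cyc_eval m (fun s => f (t :: s)).
pose g k := cyc_eval m (fun s => f (k :: s)).
transitivity (\sum_(k < p) (c - (g (t *+ k + t) - g (t *+ k)))).
  apply: eq_bigr => k _; rewrite cyc_evalB cyc_evalB.
  by rewrite (cyc_eval_bar_tail m (fun s => f (t *+ k :: s))).
rewrite !sumrB (sum_mulrnS g) subrr subr0 sumr_const card_ord -mulr_natr Ap0.
by rewrite mulr0.
Qed.

(** This is the value of [f] on the shuffle product of the 1-cycles [x], for x in [xs], with the
    standard 2m-cycle. *)
Definition slant (xs : seq T) (m : nat) (f : seq T -> A) : A :=
  cyc_eval m (foldr (@contract T A) f xs).

Lemma slant_bar_d xs m f : slant xs m (bar_d +%R f) = 0.
Proof.
(* The scalar [c] collects the signs produced as the contractions anticommute with the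
   differential. *)
suff [c [g fE]] : exists c g, foldr (@contract T A) (bar_d +%R f) xs =1
    (fun s => c * bar_d +%R g s).
  rewrite /slant (@eq_cyc_eval m _ _ (fun s _ => fE s)).
  by rewrite cyc_evalZ cyc_eval_bar_d mulr0.
elim: xs => [|x xs [c [g IHxs]]] /=.
  by exists 1, f => s; rewrite mul1r.
exists (- c), (contract x g) => s.
rewrite (eq_contract _ (fun t _ => IHxs t)) contractZ contract_bar_d ?mulrNN //.
  by rewrite mulrN mulNr.
by move=> b; rewrite addrC.
Qed.

Lemma eq_slant xs m f g :
    (forall s, size s = (size xs + m.*2)%N -> f s = g s) ->
  slant xs m f = slant xs m g.
Proof.
move=> eqfg; apply: eq_cyc_eval.
elim: xs {m}(m.*2) eqfg => [|x xs IHxs] n eqfg //= s szs.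
apply: eq_contract => s' szs'; apply: (IHxs n.+1); last by rewrite szs' szs.
by move=> s''; rewrite addnS => /eqfg.
Qed.

Lemma slant_lin xs m (I : Type) (r : seq I) (P : pred I) (c : I -> A)
    (f : I -> seq T -> A) :
  slant xs m (fun s => \sum_(i <- r | P i) c i * f i s) =
  \sum_(i <- r | P i) c i * slant xs m (f i).
Proof.
rewrite /slant; under [RHS]eq_bigr do rewrite -cyc_evalZ.
rewrite -cyc_eval_sum; apply: eq_cyc_eval => s _.
elim: xs s => [|x xs IHxs] s //=.
rewrite (eq_contract _ (fun t _ => IHxs t)) contract_sum.
by apply: eq_bigr => i _; rewrite contractZ.
Qed.

End Periodic.

Lemma raddf_slant (T : zmodType) (t : T) p (A B : comNzRingType)
    (phi : {additive A -> B}) xs m f :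
  phi (slant t p xs m f) = slant t p xs m (fun s => phi (f s)).
Proof.
rewrite /slant.
have cycE g : phi (cyc_eval t p m g) = cyc_eval t p m (fun s => phi (g s)).
  elim: m g => [|m IHm] g //=; rewrite raddf_sum; apply: eq_bigr => k _.
  exact: IHm.
rewrite cycE; apply: eq_cyc_eval => s _.
elim: xs s => [|x xs IHxs] s //=.
by rewrite raddf_contract; apply: eq_contract => s' _; apply: IHxs.
Qed.

Lemma raddf_bar_d (T : Type) (op : T -> T -> T) (A B : comNzRingType)
    (phi : {additive A -> B}) f s :
  phi (bar_d op f s) = bar_d op (fun t => phi (f t)) s.
Proof. by case: s => [|a s] /=; rewrite ?raddf0 // raddfB raddf_bar_tail. Qed.

(** * The carry cocycle *)

Section Carry.

Variable p : nat.
Hypothesis p_pr : prime p.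

Definition carry (R : comNzRingType) (a b : R) : R :=
  \sum_(1 <= k < p) ('C(p, k) %/ p)%:R * (a ^+ k * b ^+ (p - k)).

Lemma carryC (R : comNzRingType) (a b : R) : carry a b = carry b a.
Proof.
rewrite /carry big_nat_rev [LHS]big_nat [RHS]big_nat /=.
apply: eq_bigr => k /andP[k_gt0 ltkp].
rewrite add1n subSS bin_sub ?(ltnW ltkp) // subKn ?(ltnW ltkp) //.
by rewrite [a ^+ _ * _]mulrC.
Qed.

Lemma carry_mulp (R : comNzRingType) (a b : R) :
  p%:R * carry a b = (a + b) ^+ p - a ^+ p - b ^+ p.
Proof.
have p_gt0 := prime_gt0 p_pr.
rewrite [a + b]addrC exprDn.
rewrite -(big_mkord xpredT (fun i => b ^+ (p - i) * a ^+ i *+ 'C(p, i))).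
rewrite big_nat_recr //= (big_ltn p_gt0) subn0 subnn bin0 binn !expr0 !mulr1n.
set S := \sum_(1 <= i < p) _; suff -> : p%:R * carry a b = S by ring.
rewrite /S /carry mulr_sumr [LHS]big_nat [RHS]big_nat; apply: eq_bigr => k kp.
rewrite mulrA -natrM mulnC divnK ?prime_dvd_bin // mulr_natl mulrC.
by rewrite [b ^+ _ * _]mulrC.
Qed.

Lemma rmorph_carry (R S : comNzRingType) (phi : {rmorphism R -> S}) a b :
  phi (carry a b) = carry (phi a) (phi b).
Proof.
rewrite rmorph_sum; apply: eq_bigr => k _.
by rewrite !rmorphM !rmorphXn rmorph_nat.
Qed.

Lemma carryM (R : comNzRingType) (c a b : R) :
  carry (c * a) (c * b) = c ^+ p * carry a b.
Proof.
rewrite /carry mulr_sumr [LHS]big_nat [RHS]big_nat.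
apply: eq_bigr => k /andP[_ ltkp].
have -> : c ^+ p = c ^+ k * c ^+ (p - k) by rewrite -exprD subnKC // ltnW.
by rewrite !exprMn; ring.
Qed.

Local Notation ZXYZ := {poly {poly {poly int}}}.

(* By naturality it is enough to treat the generic a, b, c in Z[a, b, c],      *)
(* where p can be cancelled.                                                   *)
Lemma carry_cocycle (R : comNzRingType) (a b c : R) :
  carry b c - carry (a + b) c + carry a (b + c) - carry a b = 0.
Proof.
have hf : commr_rmorph (intmul 1 : int -> R) a by move=> x; apply: mulrC.
have hg : commr_rmorph (horner_morph hf) b by move=> x; apply: mulrC.
have hh : commr_rmorph (horner_morph hg) c by move=> x; apply: mulrC.
pose phi : {rmorphism ZXYZ -> R} := horner_morph hh.
pose X : ZXYZ := ('X%:P)%:P; pose Y : ZXYZ := 'X%:P; pose Z : ZXYZ := 'X.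
have phiX : phi X = a.
  by rewrite /phi /= horner_morphC /= horner_morphC /= horner_morphX.
have phiY : phi Y = b by rewrite /phi /= horner_morphC /= horner_morphX.
have phiZ : phi Z = c by rewrite /phi /= horner_morphX.
transitivity (phi (carry Y Z - carry (X + Y) Z + carry X (Y + Z) - carry X Y)).
  rewrite rmorphB rmorphD rmorphB !(rmorph_carry phi).
  by rewrite !(rmorphD phi) phiX phiY phiZ.
rewrite -[RHS](rmorph0 phi); congr (phi _).
have p_neq0 : (p%:R : ZXYZ) != 0.
  rewrite -!polyC_natr !polyC_eq0 pnatr_eq0 -lt0n; exact: prime_gt0.
apply: (mulfI p_neq0); rewrite mulr0 mulrBr mulrDr mulrBr !carry_mulp.
rewrite [X + (Y + Z)]addrA.
move: ((X + Y + Z) ^+ p) ((X + Y) ^+ p) ((Y + Z) ^+ p) => x y z.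
by move: (X ^+ p) (Y ^+ p) (Z ^+ p) => x' y' z'; ring.
Qed.

(** This is the value of the carry class on the standard 2-cycle of the prime field; over the
    integers it is [p ^ p.-1 - 1]. *)
Lemma sum_carry1 (R : comNzRingType) : p \in [pchar R] ->
  \sum_(k < p) carry (1 *+ k) 1 = -1 :> R.
Proof.
move=> pcharRp; have p_gt1 := prime_gt1 p_pr.
(* Telescoping over the integers: p * carry k 1 = (k + 1)^p - k^p - 1. *)
have sumZ n : p%:R * (\sum_(k < n) carry k%:R 1 : int) = n%:R ^+ p - n%:R.
  elim: n => [|n IHn]; first by rewrite big_ord0 mulr0 expr0n -leqn0 leqNgt ltnW.
  by rewrite big_ord_recr mulrDr IHn /= carry_mulp -natr1 expr1n; ring.
have pZ_neq0 : (p%:R : int) != 0 by rewrite pnatr_eq0; lia.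
have {}sumZ : (\sum_(k < p) carry k%:R 1 : int) = p%:R ^+ p.-1 - 1.
  apply: (mulfI pZ_neq0); rewrite sumZ mulrBr mulr1 -exprS prednK //; lia.
have := congr1 (intmul 1 : int -> R) sumZ.
rewrite rmorph_sum rmorphB rmorph1 rmorphXn rmorph_nat /= (pcharf0 pcharRp).
rewrite expr0n -subn1 subn_eq0 leqNgt p_gt1 /= sub0r => <-.
by apply: eq_bigr => k _; rewrite rmorph_carry rmorph_nat rmorph1.
Qed.

End Carry.

(** * A cocycle of the additive group of a finite field *)

Section Omega.

Variables (F : finFieldType) (p : nat).
Hypothesis charFp : p \in [pchar F].

Let p_pr : prime p := pcharf_prime charFp.

Definition omega (js es : seq nat) : seq F -> F :=
  foldr (fun j => cup1 (fun a => a ^+ (p ^ j)))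
    (foldr (fun e => cup2 (fun a b => carry p a b ^+ (p ^ e))) (@cup0 F F) es) js.

Lemma exprD_pXn (a b : F) e : (a + b) ^+ (p ^ e) = a ^+ (p ^ e) + b ^+ (p ^ e).
Proof. by rewrite exprDn_pchar // (eq_pnat _ (pcharf_eq charFp)) pnatX pnat_id. Qed.

Lemma exprN_pXn (a : F) e : (- a) ^+ (p ^ e) = - a ^+ (p ^ e).
Proof.
apply/eqP; rewrite -addr_eq0 -exprD_pXn addNr expr0n.
by rewrite -leqn0 leqNgt expn_gt0 prime_gt0.
Qed.

Lemma bar_d_omega js es s : bar_d +%R (omega js es) s = 0.
Proof.
elim: js s => [|j js IHj] s; last first.
  by apply: bar_d_cup1 => // a b; rewrite exprD_pXn.
elim: es s => [|e es IHe] s; first exact: bar_d_cup0.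
apply: bar_d_cup2 => // a b c.
rewrite -!exprN_pXn -!exprD_pXn carry_cocycle // expr0n.
by rewrite -leqn0 leqNgt expn_gt0 prime_gt0.
Qed.

Lemma omega_scale js es c s :
  omega js es (map ( *%R c) s) =
  c ^+ (\sum_(j <- js) p ^ j + \sum_(e <- es) p ^ e.+1) * omega js es s.
Proof.
elim: js s => [|j js IHj] s; last first.
  case: s => [|a s] /=; first by rewrite mulr0.
  by rewrite IHj big_cons -addnA [in RHS]exprD exprMn mulrACA.
rewrite big_nil add0n; elim: es s => [|e es IHe] s.
  by case: s => [|a s] /=; rewrite ?big_nil ?mulr1 ?mulr0.
case: s => [|a [|b s]] /=; rewrite ?mulr0 //.
rewrite [foldr _ _ _ _]IHe big_cons exprD carryM // exprMn -exprM expnS.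
by rewrite [RHS]mulrACA.
Qed.

(** The value is a product of Frobenius powers of -1, one for each carry factor. *)
Lemma cyc_eval_omega es : cyc_eval (1 : F) p (size es) (omega [::] es) != 0.
Proof.
elim: es => [|e es IHe] /=; first exact: oner_neq0.
set c := cyc_eval _ _ _ _ in IHe.
have -> : \sum_(k < p) cyc_eval (1 : F) p (size es)
    (fun s => cup2 (fun a b => carry p a b ^+ (p ^ e)) (omega [::] es)
       (1 *+ k :: 1 :: s)) = (\sum_(k < p) carry p (1 *+ k) 1) ^+ (p ^ e) * c.
  transitivity ((\sum_(k < p) carry p (1 *+ k : F) 1 ^+ (p ^ e)) * c).
    by rewrite mulr_suml; apply: eq_bigr => k _; rewrite cyc_evalZ.
  congr (_ * _); elim/big_ind2: _ => // [|x1 x2 y1 y2 -> ->].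
    by rewrite expr0n -leqn0 leqNgt expn_gt0 prime_gt0.
  by rewrite exprD_pXn.
by rewrite mulf_neq0 // sum_carry1 // exprN_pXn expr1n oppr_eq0 oner_neq0.
Qed.

(** Contraction is a signed derivation on the degree-one factors and kills the product of carry
    factors, which are symmetric. Only the coefficient belonging to the head of [js] has to be known
    exactly. *)
Lemma contract_omega js es : uniq js ->
  exists v : nat -> seq F -> F,
    (forall x s, contract x (omega js es) s =
                 \sum_(j <- js) x ^+ (p ^ j) * v j s) /\
    (forall j js', js = j :: js' -> v j = omega js' es).
Proof.
elim: js => [|j js IHj] /= => [_|/andP[jNjs /IHj[v [vE _]]]].
  exists (fun _ _ => 0); split=> // x s; rewrite big_nil.
  elim: es s => [|e es IHe] s; first exact: contract_cup0.
  rewrite contract_cup2 /= => [|a]; last by rewrite carryC.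
  by case: s => [|a [|b s]] //=; rewrite [contract _ _ _]IHe mulr0.
exists (fun i => if i == j then omega js es
                 else fun s => - cup1 (fun a => a ^+ (p ^ j)) (v i) s).
split=> [x s|i js' [-> ->]]; last by rewrite eqxx.
rewrite contract_cup1 big_cons eqxx; congr (_ + _).
rewrite big_seq -[LHS]mulN1r.
transitivity (\sum_(i <- js) x ^+ (p ^ i) * - cup1 (fun a => a ^+ (p ^ j)) (v i) s).
  case: s => [|a s] /=; first by rewrite mulr0 big1 // => i _; rewrite oppr0 mulr0.
  rewrite [contract _ _ _]vE !mulr_sumr; apply: eq_bigr => i _; ring.
rewrite big_seq; apply: eq_bigr => i ijs.
by case: eqP ijs jNjs => // -> ->.
Qed.

(** The sum is the value at [x] of a nonzero polynomial of degree less than [p ^ r], which cannot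
    vanish on all of [F]. *)
Lemma sum_frob_neq0 (r : nat) (c : nat -> F) j js :
    (p ^ r <= #|F|)%N -> uniq (j :: js) -> all (ltn^~ r) (j :: js) -> c j != 0 ->
  exists x : F, \sum_(i <- j :: js) x ^+ (p ^ i) * c i != 0.
Proof.
move=> leF ujs jsr cj_neq0.
pose P : {poly F} := \sum_(i <- j :: js) c i *: 'X^(p ^ i).
have Pj : P`_(p ^ j) = c j.
  rewrite /P coef_sum big_cons coefZ coefXn eqxx mulr1 big_seq big1 ?addr0 // => i ijs.
  rewrite coefZ coefXn eqn_exp2l ?prime_gt1 //.
  by case: eqP ijs ujs => [<- /= ->|]; rewrite ?mulr0.
have P_neq0 : P != 0 by apply: contraNneq cj_neq0 => P0; rewrite -Pj P0 coef0.
have szP : (size P <= p ^ r)%N.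
  apply: (leq_trans (size_sum _ _ _)); apply/bigmax_leqP_seq => i ijs _.
  apply: (leq_trans (size_scale_leq _ _)); rewrite size_polyXn.
  by rewrite ltn_exp2l ?prime_gt1 //; apply: (allP jsr).
have [x Px] : exists x : F, ~~ root P x.
  apply/existsP; apply: contraLR leF; rewrite negb_exists -ltnNge => /forallP rP.
  apply: leq_trans szP; rewrite cardE max_poly_roots ?enum_uniq //.
  by apply/allP => x _; have := rP x; rewrite negbK.
exists x; apply: contra Px => /eqP s0; apply/rootP.
rewrite /P horner_sum -[RHS]s0; apply: eq_bigr => i _.
by rewrite hornerZ hornerXn mulrC.
Qed.

Lemma slant_omega (r : nat) js es :
    (p ^ r <= #|F|)%N -> uniq js -> all (ltn^~ r) js ->
  exists2 xs : seq F, size xs = size js &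
    slant 1 p xs (size es) (omega js es) != 0.
Proof.
move=> leF; elim: js => [|j js IHj] ujs jsr.
  by exists [::]; last exact: cyc_eval_omega.
have [xs szxs nz] : exists2 xs : seq F, size xs = size js &
    slant 1 p xs (size es) (omega js es) != 0.
  by apply: IHj; [case/andP: ujs | case/andP: jsr].
have [v [vE vj]] := contract_omega es ujs.
have nz' : slant 1 p xs (size es) (v j) != 0 by rewrite (vj j js).
have [x nzx] := @sum_frob_neq0 r (fun i => slant 1 p xs (size es) (v i))
  j js leF ujs jsr nz'.
(* The last entry is contracted first, so the new element removes the head factor of [omega] before
   [xs] acts. *)
exists (rcons xs x); first by rewrite size_rcons szxs.
rewrite /slant foldr_rcons -/(slant 1 p xs (size es) _).
by rewrite (eq_slant _ _ (fun s _ => vE x s)) slant_lin.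
Qed.

End Omega.

(** * Transfer along an action *)

Section Transfer.

Variables (G : Type) (op : G -> G -> G) (T : zmodType) (A : comNzRingType).
Variables (X : finType) (S : {set X}) (act : X -> G -> X) (c : X -> G -> T).

Fixpoint trace (x : X) (s : seq G) : seq T :=
  if s is g :: s' then c x g :: trace (act x g) s' else [::].

Definition transfer (w : seq T -> A) (s : seq G) : A :=
  \sum_(x in S) w (trace x s).

Hypothesis actS : forall x g, x \in S -> act x g \in S.
Hypothesis act_inj : forall g, {in S &, injective (act^~ g)}.
Hypothesis actM : forall x g h, x \in S -> act x (op g h) = act (act x g) h.
Hypothesis cM : forall x g h, x \in S -> c x (op g h) = c x g + c (act x g) h.

Lemma bar_tail_trace (w : seq T -> A) x g s : x \in S ->
  bar_tail op (fun t => w (trace x t)) g s =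
  bar_tail +%R w (c x g) (trace (act x g) s).
Proof.
elim: s w x g => [|h s IHs] w x g xS //=.
by rewrite actM // cM // (IHs (fun t => w (c x g :: t))) ?actS.
Qed.

(** Reindexing the face that drops [g] by the permutation [act^~ g] of [S] makes each [x] contribute
    the differential of [w] at the trace of [g :: s] from [x]. *)
Lemma bar_d_transfer (w : seq T -> A) s :
  (forall t, bar_d +%R w t = 0) -> bar_d op (transfer w) s = 0.
Proof.
move=> w0; case: s => [|g s] //=.
rewrite /transfer bar_tail_sum.
have imS : [set act x g | x in S] = S.
  apply/eqP; rewrite eqEcard card_in_imset ?leqnn ?andbT; last exact: act_inj.
  by apply/subsetP => _ /imsetP[x xS ->]; apply: actS.
rewrite -{1}imS big_imset /=; last exact: act_inj.
rewrite -sumrB big1 // => x xS; rewrite bar_tail_trace //.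
exact: (w0 (c x g :: trace (act x g) s)).
Qed.

End Transfer.

(** On a free orbit a unique [t x] moves [x] to the chosen representative, and [b x := c x (t x)]
    works because [a + t (act x a) = t x]. One [b] serves all free orbits at once. *)
Lemma free_trivialization (T V : finZmodType) (X : finType) (S : {set X})
    (act : X -> T -> X) (c : X -> T -> V) :
    (forall x a, x \in S -> act x a \in S) ->
    (forall x, x \in S -> act x 0 = x) ->
    (forall x a b, x \in S -> act x (a + b) = act (act x a) b) ->
    (forall x a b, x \in S -> c x (a + b) = c x a + c (act x a) b) ->
  exists b : X -> V, forall x, x \in S ->
    (forall a, act x a = x -> a = 0) ->
    forall a, c x a + b (act x a) - b x = 0.
Proof.
move=> actS act0 actD cD.
pose rep x := odflt x [pick y | [exists a, act x a == y]].
pose t x := odflt 0 [pick a | act x a == rep x].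
have tP x : x \in S -> act x (t x) = rep x.
  move=> xS; rewrite /t; case: pickP => [a /eqP //|/=].
  rewrite /rep; case: pickP => [y /existsP[a /eqP <-] /(_ a)|/(_ x)/existsP[]].
    by rewrite eqxx.
  by exists 0; rewrite act0.
exists (fun x => c x (t x)) => x xS free a.
have actN y : y \in S -> act (act y a) (- a) = y.
  by move=> yS; rewrite -actD // subrr act0.
have repa : rep (act x a) = rep x.
  rewrite /rep.
  have -> : [pick y | [exists a0, act (act x a) a0 == y]] =
            [pick y | [exists a0, act x a0 == y]].
    apply: eq_pick => y; apply/existsP/existsP => -[d /eqP <-].
      by exists (a + d); rewrite actD.
    by exists (- a + d); rewrite -actD // addrA subrr add0r.
  by case: pickP => // /(_ x)/existsP[]; exists 0; rewrite act0.
suff <- : a + t (act x a) = t x by rewrite cD // subrr.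
apply/eqP; rewrite -subr_eq0; apply/eqP/free.
rewrite actD // actD // tP ?actS // repa -tP // -actD // subrr.
exact: act0.
Qed.

(** * Restriction of the transfer along [eps] *)

Section RestrictedTransfer.

Variables (G : Type) (op : G -> G -> G) (T V : finZmodType) (A : comNzRingType).
Variables (X : finType) (S : {set X}) (act : X -> G -> X) (c : X -> G -> V).
Variable (eps : T -> G).

Hypothesis actS : forall x g, x \in S -> act x g \in S.
Hypothesis act_inj : forall g, {in S &, injective (act^~ g)}.
Hypothesis actM : forall x g h, x \in S -> act x (op g h) = act (act x g) h.
Hypothesis cM : forall x g h, x \in S -> c x (op g h) = c x g + c (act x g) h.
Hypothesis epsD : forall a b, eps (a + b) = op (eps a) (eps b).
Hypothesis act_eps0 : forall x, x \in S -> act x (eps 0) = x.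

Definition fixset := [set x in S | [forall a, act x (eps a) == x]].

Hypothesis fix_or_free : forall x a,
  x \in S -> act x (eps a) = x -> a != 0 -> x \in fixset.

Lemma exists_transfer (w : seq V -> A) :
    (forall t, bar_d +%R w t = 0) -> (forall n, w (nseq n 0) = 0) ->
  exists2 f : seq G -> A, (forall s, bar_d op f s = 0) &
    forall s, f (map eps s) = \sum_(x in fixset) w (map (fun a => c x (eps a)) s).
Proof.
move=> wc w0.
have [x a xS|x xS|x a b xS|x a b xS|b bP] :=
  @free_trivialization T V X S (fun x a => act x (eps a)) (fun x a => c x (eps a)).
- exact: actS.
- exact: act_eps0.
- by rewrite epsD actM.
- by rewrite epsD cM.
(* Changing [c] by the coboundary of [b] leaves it unchanged along [eps] at fixed points and makes
   it zero there on free orbits, where [w] then sees only zeros. *)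
pose c' x g := c x g + b (act x g) - b x.
exists (transfer S act c' w) => s.
  apply: bar_d_transfer => // x g h xS; rewrite /c' cM // actM //.
  have shift (u v y z d : V) : u + v + y - z = (u + d - z) + (v + y - d).
    rewrite [RHS]addrC [u + d]addrC -[d + u - z]addrA [RHS]addrA subrK [RHS]addrA.
    by rewrite -[u + v + y]addrA [u + _]addrC.
  exact: shift.
rewrite /transfer (bigID [pred x | [forall a, act x (eps a) == x]]) /=.
rewrite [X in _ + X]big1 ?addr0 => [|x /andP[xS xNfix]].
  apply: eq_big => [x|x /andP[xS /forallP xfix]]; first by rewrite inE.
  congr w; elim: s => //= a s; rewrite (eqP (xfix a)) => ->.
  by rewrite /c' (eqP (xfix a)) addrK.
suff -> : trace act c' x (map eps s) = nseq (size s) 0 by [].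
elim: s x xS xNfix => //= a s IHs x xS xNfix.
have xfree d : act x (eps d) = x -> d = 0.
  move=> xd; apply/eqP; apply: contraR xNfix => d_neq0.
  by have := fix_or_free xS xd d_neq0; rewrite inE => /andP[].
rewrite /c' (bP x xS xfree a) IHs ?actS //.
apply: contra xNfix => /forallP fixa; apply/forallP => d.
have /eqP := fixa (- a); rewrite -actM // -epsD subrr act_eps0 // => xa.
by have := fixa d; rewrite -xa.
Qed.

End RestrictedTransfer.

(** * Comparison with the complex of finite functions *)

Section BarOfSeq.

Variables (gT : finGroupType) (A : finComNzRingType).

(** This is the face of index [i.+1] of [a :: s]; at [i = size s] the recursion runs to the end and
    drops the last entry. *)
Fixpoint face_at (i : nat) (a : gT) (s : seq gT) : seq gT :=
  if s is b :: s' then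
    if i is i'.+1 then a :: face_at i' b s' else (a * b)%g :: s'
  else [::].

Lemma size_face_at i a s : size (face_at i a s) = size s.
Proof. by elim: s i a => [|b s IHs] [|i] a //=; rewrite IHs. Qed.

Lemma nth_face_at i a s k : (k < size s)%N ->
  nth 1%g (face_at i a s) k =
    if (k < i)%N then nth 1%g (a :: s) k
    else if k == i then (nth 1 (a :: s) k * nth 1 s k)%g else nth 1%g s k.
Proof.
elim: s i a k => [|b s IHs] [|i] a [|k] //= ltks.
by rewrite IHs // ltnS eqSS.
Qed.

Lemma bar_tailE (f : seq gT -> A) a s :
  bar_tail (fun x y => x * y)%g f a s =
  \sum_(i < (size s).+1) (-1) ^+ i * f (face_at i a s).
Proof.
elim: s f a => [|b s IHs] f a /=; first by rewrite big_ord1 mul1r.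
rewrite big_ord_recl mul1r IHs -sumrN; congr (_ + _).
by apply: eq_bigr => i _; rewrite exprS mulN1r mulNr.
Qed.

Lemma codom_ffunS m (g : {ffun 'I_m.+1 -> gT}) :
  codom g = g ord0 :: [seq g (lift ord0 i) | i : 'I_m].
Proof. by rewrite codomE enum_ordSl /= -map_comp. Qed.

Lemma codom_bar_face m (i : 'I_m.+1) (g : {ffun 'I_m.+1 -> gT}) :
  codom (bar_face (lift ord0 i) g) =
  face_at i (g ord0) [seq g (lift ord0 j) | j : 'I_m].
Proof.
apply: (@eq_from_nth _ 1%g).
  by rewrite size_face_at size_codom size_image.
move=> k; rewrite size_codom card_ord => ltkm.
pose k' := Ordinal ltkm.
have nthL (h : 'I_m -> gT) : nth 1%g [seq h j | j : 'I_m] k = h k'.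
  by rewrite (nth_map k') ?size_enum_ord // (nth_ord_enum _ k').
have nthS : nth 1%g (g ord0 :: [seq g (lift ord0 j) | j : 'I_m]) k =
    g (lift ord_max k').
  rewrite -codom_ffunS codomE (nth_map ord0) ?size_enum_ord; last by rewrite ltnS ltnW.
  congr (g _); apply: val_inj; rewrite /= nth_enum_ord; last by rewrite ltnS ltnW.
  by rewrite /bump leqNgt ltkm.
rewrite nth_face_at ?size_image ?card_ord // nthS.
rewrite (nthL (fun j => g (lift ord0 j))) codomE (nthL (bar_face _ g)) ffunE.
by rewrite /= /bump add1n ltnS eqSS.
Qed.

Lemma bar_d_codom m (K : seq gT -> A) (g : {ffun 'I_m.+1 -> gT}) :
  \sum_(i < m.+2) (if odd i then - K (codom (bar_face i g))
                   else K (codom (bar_face i g))) =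
  bar_d (fun x y => x * y)%g K (codom g).
Proof.
rewrite big_ord_recl /= codom_ffunS /= bar_tailE -sumrN size_image card_ord.
congr (K _ + _).
  rewrite codomE; apply: eq_map => k; rewrite ffunE /=; by [].
apply: eq_bigr => i _; rewrite codom_bar_face /= -signr_odd.
by case: (odd i); rewrite ?mulN1r ?mul1r ?opprK.
Qed.

(** The cochain group is abelian, so a trivial quotient puts every cocycle among the coboundaries,
    including the one [f] induces in degree [m.+1]. *)
Lemma cohomology_neq1 m (f : seq gT -> A) :
    (forall s, bar_d (fun x y => x * y)%g f s = 0) ->
    (forall h : seq gT -> A, ~ forall s, size s = m.+1 ->
      f s = bar_d (fun x y => x * y)%g h s) ->
  cohomology gT A m.+1 :!=: 1%g.
Proof.
move=> fc fnb; apply/eqP => /= H1.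
have abC : abelian [set: cochain gT A m.+1].
  by apply/centsP => x _ y _; apply: addrC.
have : cocycles gT A m.+1 \subset coboundaries gT A m.+1.
  rewrite -quotient_sub1; first by rewrite H1.
  exact: subset_trans (subsetT _) (sub_abelian_norm abC (subsetT _)).
pose f' : cochain gT A m.+1 := [ffun g : {ffun 'I_m.+1 -> gT} => f (codom g)].
move/subsetP/(_ f').
case/(_ _)/morphimP.
  apply/kerP; rewrite ?inE //; apply/ffunP => g; rewrite !ffunE.
  under eq_bigr do rewrite ffunE.
  by rewrite bar_d_codom fc.
move=> h _ _ /ffunP fh; apply: (fnb (fun s => h [ffun i : 'I_m => nth 1%g s i])).
move=> s szs; pose g := [ffun i : 'I_m.+1 => nth 1%g s i].
have sE : s = codom g.
  apply: (@eq_from_nth _ 1%g); first by rewrite size_codom card_ord.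
  move=> k; rewrite szs => ltk; rewrite codomE (nth_map ord0) ?size_enum_ord //.
  by rewrite ffunE nth_enum_ord.
rewrite sE -bar_d_codom; have := fh g; rewrite !ffunE => ->.
have codomK (u : {ffun 'I_m -> gT}) : [ffun i : 'I_m => nth 1%g (codom u) i] = u.
  apply/ffunP => i; rewrite ffunE codomE (nth_map i) ?size_enum_ord //.
  by rewrite nth_ord_enum.
by apply: eq_bigr => i _; rewrite codomK.
Qed.

End BarOfSeq.

(** * The action of GL_n on flags *)

Section Flags.

Variables (F : finFieldType) (n : nat).
Local Notation V := 'rV[F]_n.+2.
Local Notation G := {'GL_n.+2[F]}.

(* A linear form in u with [ell v v = 1] when v != 0, so that each class modulo *)
(* v has exactly one representative u with [ell v u = 0].                      *)
Definition ell (v u : V) : F :=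
  if [pick i | v 0 i != 0] is Some i then u 0 i / v 0 i else 0.

Lemma ell_lin v a u w : ell v (a *: u + w) = a * ell v u + ell v w.
Proof.
rewrite /ell; case: pickP => [i _|_]; first by rewrite !mxE; ring.
by rewrite mulr0 addr0.
Qed.

Lemma ell_self v : v != 0 -> ell v v = 1.
Proof.
move=> v_neq0; rewrite /ell; case: pickP => [i vi|v0]; first by rewrite divff.
by case/negP: v_neq0; apply/eqP/rowP => i; have /eqP := negbFE (v0 i); rewrite mxE.
Qed.

(** A class modulo [x.1] is stored as its normalised representative; the second vector may therefore
    be zero. *)
Definition flags : {set V * V} := [set x | (x.1 != 0) && (ell x.1 x.2 == 0)].

Definition flag_cocycle (x : V * V) (g : G) : F :=
  ell (x.1 *m GLval g) (x.2 *m GLval g).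

Definition flag_act (x : V * V) (g : G) : V * V :=
  (x.1 *m GLval g, x.2 *m GLval g - flag_cocycle x g *: (x.1 *m GLval g)).

Lemma mulGL_inj (g : G) : injective (fun v : V => v *m GLval g).
Proof. by apply: can_inj (mulmxK _); apply: GL_unitmx. Qed.

Lemma mulGL_neq0 (g : G) (v : V) : v != 0 -> v *m GLval g != 0.
Proof. by apply: contraNneq => vg0; apply/eqP/(@mulGL_inj g); rewrite mul0mx. Qed.

Lemma flag_actS x g : x \in flags -> flag_act x g \in flags.
Proof.
rewrite !inE => /andP[x1 _]; rewrite /= mulGL_neq0 //=.
rewrite -scaleNr addrC ell_lin ell_self ?mulGL_neq0 // mulr1.
by rewrite addNr.
Qed.

Lemma flag_cocycleM x g h : x \in flags ->
  flag_cocycle x (g * h)%g = flag_cocycle x g + flag_cocycle (flag_act x g) h.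
Proof.
rewrite inE => /andP[x1 _]; rewrite [flag_cocycle (flag_act _ _) _]/flag_cocycle /=.
rewrite mulmxBl -scalemxAl -scaleNr addrC addrC [_ + (- _ *: _)]addrC ell_lin.
rewrite ell_self ?mulGL_neq0 // mulr1 addNKr.
by rewrite /flag_cocycle GL_MxE !mulmxA.
Qed.

Lemma flag_actM x g h : x \in flags ->
  flag_act x (g * h)%g = flag_act (flag_act x g) h.
Proof.
move=> xS; rewrite {1}/flag_act flag_cocycleM // GL_MxE !mulmxA.
congr (_, _) => /=.
by rewrite mulmxBl -scalemxAl scalerDl opprD addrA.
Qed.

(** Equal images force equal first vectors [v] and second vectors differing by a multiple of [v];
    the normalisation makes this multiple zero. *)
Lemma flag_act_inj g : {in flags &, injective (flag_act^~ g)}.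
Proof.
move=> [v u] [w z]; rewrite !inE /= => /andP[v_neq0 /eqP vu] /andP[_ /eqP wz].
rewrite /flag_act /= => -[/mulGL_inj vw]; rewrite -{w}vw in wz *.
move: (flag_cocycle _ g) (flag_cocycle _ g) => d c E.
have uE : u = (c - d) *: v + z.
  apply: (@mulGL_inj g); rewrite mulmxDl -scalemxAl scalerBl.
  by rewrite -[LHS](subrK (c *: (v *m GLval g))) E -addrA addrC [- _ + _]addrC.
have := vu; rewrite uE ell_lin wz ell_self // mulr1 addr0 => ->.
by rewrite scale0r add0r.
Qed.

(** * The substitutions P(X) |-> P(X + a) as matrices *)

Definition translation (a : F) : 'M[F]_n.+2 :=
  \matrix_(i < n.+2) poly_rV (('X + a%:P) ^+ i).

Lemma rVpoly_translation a (v : V) :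
  rVpoly (v *m translation a) = rVpoly v \Po ('X + a%:P).
Proof.
have vE : rVpoly v = \sum_(i < n.+2) v 0 i *: 'X^i.
  rewrite /rVpoly poly_def; apply: eq_bigr => i _.
  by rewrite insubT //= => lti; congr (v 0 _ *: _); apply: val_inj.
rewrite mulmx_sum_row raddf_sum vE raddf_sum; apply: eq_bigr => i _ /=.
rewrite linearZ /= comp_polyZ comp_Xn_poly rowK poly_rV_K //.
by rewrite -[a%:P]opprK -polyCN size_exp_XsubC.
Qed.

Lemma translationD a b : translation (a + b) = translation a *m translation b.
Proof.
apply/row_matrixP => i; rewrite !rowE mulmxA.
apply: (can_inj rVpolyK); rewrite !rVpoly_translation -comp_polyA.
by rewrite comp_polyD comp_polyX comp_polyC -addrA -polyCD [b + a]addrC.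
Qed.

Lemma translation0 : translation 0 = 1%:M.
Proof.
apply/row_matrixP => i; rewrite !rowE mulmx1.
by apply: (can_inj rVpolyK); rewrite rVpoly_translation addr0 comp_polyXr.
Qed.

Lemma translation_unit a : translation a \in unitmx.
Proof.
by have [|//] := @mulmx1_unit _ _ (translation a) (translation (- a));
  rewrite -translationD subrr translation0.
Qed.

Definition translationGL (a : F) : G := FinRing.unit _ (translation_unit a).

Lemma translationGLD a b :
  translationGL (a + b) = (translationGL a * translationGL b)%g.
Proof. by apply: val_inj; apply: translationD. Qed.

Lemma flag_act_translation0 x : x \in flags -> flag_act x (translationGL 0) = x.
Proof.
case: x => v u; rewrite inE /flag_act /flag_cocycle /= translation0 !mulmx1.
by case/andP => _ /eqP->; rewrite scale0r subr0.
Qed.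

End Flags.

(** * Translations of polynomials *)

(** Over the prime field [F] is a vector space, and some coordinate of a nonzero vector in a basis
    is nonzero. *)
Lemma exists_additive_neq0 (F : finFieldType) (p : nat) (x : F) :
    p \in [pchar F] -> x != 0 ->
  exists phi : {additive F -> 'F_p}, phi x != 0.
Proof.
move=> charFp x_neq0; pose L : vectType 'F_p := pPrimeCharType charFp.
pose y : L := x.
have [i yi] : exists i, coord (vbasis {: L}) i y != 0.
  apply/existsP; apply: contraR x_neq0; rewrite negb_exists => /forallP y0.
  change (y == 0); rewrite (coord_vbasis (memvf y)) big1 // => i _.
  by have /eqP-> := negbNE (y0 i); rewrite scale0r.
have cB : zmod_morphism (coord (vbasis {: L}) i : F -> 'F_p).
  by move=> u v; exact: (raddfB (coord (vbasis {: L}) i) (u : L) (v : L)).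
pose phiM := GRing.isZmodMorphism.Build F 'F_p _ cB.
pose phi : {additive F -> 'F_p} := HB.pack (coord (vbasis {: L}) i : F -> 'F_p) phiM.
by exists phi.
Qed.

(** * Flags fixed by a translation *)

Section FixedFlags.

Variables (F : finFieldType) (p n : nat).
Hypothesis charFp : p \in [pchar F].
Hypothesis le_n_p : (n.+2 <= p)%N.

(** An invariant [P] takes one value at the [p] distinct points [a *+ k], too many for a nonconstant
    polynomial of degree less than [p]. *)
Lemma shift_invariant_const (P : {poly F}) a :
    a != 0 -> (size P <= p)%N -> P \Po ('X + a%:P) = P -> P = (P`_0)%:P.
Proof.
move=> a_neq0 szP Pa.
have Pk k : P.[a *+ k] = P.[0].
  elim: k => [|k IHk]; first by rewrite mulr0n.
  by rewrite -IHk -{2}Pa horner_comp !hornerE mulrSr.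
have szQ : (size (P - P.[0]%:P)%R <= p)%N.
  rewrite (leq_trans (size_polyD _ _)) // size_polyN geq_max szP.
  by rewrite (leq_trans (size_polyC_leq1 _)) // (leq_trans _ le_n_p).
suff : P - P.[0]%:P == 0 by rewrite subr_eq0 horner_coef0 => /eqP.
apply: contraLR szQ => Q_neq0; rewrite -ltnNge.
rewrite -[X in (X < _)%N](size_iota 0 p) -(size_map (fun k => a *+ k)).
apply: max_poly_roots => //.
  by apply/allP => _ /mapP[k _ ->]; rewrite rootE !hornerE Pk subrr.
rewrite map_inj_in_uniq ?iota_uniq // => i j; rewrite !mem_iota !add0n /=.
wlog le_ij : i j / (i <= j)%N.
  move=> IH ip jp; case/orP: (leq_total i j) => [/IH|/IH h /esym/h]; first exact.
  by move=> h'; rewrite h'.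
move=> _ jp /eqP; rewrite eq_sym -subr_eq0 -mulrnBr // -mulr_natl mulf_eq0.
rewrite (negPf a_neq0) orbF -(dvdn_pcharf charFp) => /dvdn_leq; lia.
Qed.

Local Notation e0 := (delta_mx 0 0 : 'rV[F]_n.+2).
Local Notation e1 := (delta_mx 0 1 : 'rV[F]_n.+2).

Lemma ell_e1 (l m : F) : ell (l *: e0) (m *: e1) = 0.
Proof.
rewrite /ell; case: pickP => // i; rewrite !mxE.
by have [->|_] := eqVneq i 0; rewrite /= !mulr0 ?mul0r ?eqxx.
Qed.

Lemma e0_translation (a : F) : e0 *m translation n a = e0.
Proof.
apply: (can_inj rVpolyK); rewrite rVpoly_translation rVpoly_delta expr0.
by rewrite -polyC1 comp_polyC.
Qed.

Lemma e1_translation (a : F) : e1 *m translation n a = e1 + a *: e0.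
Proof.
apply: (can_inj rVpolyK); rewrite rVpoly_translation linearD linearZ /=.
by rewrite !rVpoly_delta expr0 expr1 comp_polyX alg_polyC.
Qed.

Definition basis_flag (lm : F * F) := (lm.1 *: e0, lm.2 *: e1).

Lemma basis_flagP lm : lm.1 != 0 -> basis_flag lm \in flags F n.
Proof.
case: lm => l m /= l_neq0; rewrite inE /= ell_e1 eqxx andbT scaler_eq0.
rewrite (negPf l_neq0) /=.
by apply/eqP => /rowP/(_ 0)/eqP; rewrite !mxE oner_eq0.
Qed.

Lemma flag_cocycle_basis lm a : lm.1 != 0 ->
  flag_cocycle (basis_flag lm) (translationGL n a) = lm.2 / lm.1 * a.
Proof.
case: lm => l m /= l_neq0; have := basis_flagP (lm := (l, m)) l_neq0.
rewrite inE => /andP[/ell_self/= ll _].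
rewrite /flag_cocycle /= -!scalemxAl e0_translation e1_translation.
rewrite scalerDr addrC scalerA -[m * a](mulfVK l_neq0) -scalerA ell_lin ll ell_e1.
by rewrite addr0 mulr1 mulrAC.
Qed.

Lemma flag_act_basis lm a : lm.1 != 0 ->
  flag_act (basis_flag lm) (translationGL n a) = basis_flag lm.
Proof.
move=> l_neq0; rewrite /flag_act flag_cocycle_basis //=.
case: lm l_neq0 => l m /= l_neq0.
rewrite -!scalemxAl e0_translation e1_translation /basis_flag /=; congr (_, _).
by rewrite scalerDr !scalerA mulrAC mulfVK // addrK.
Qed.

Lemma translation_fixed x a : x \in flags F n -> a != 0 ->
    flag_act x (translationGL n a) = x ->
  exists2 lm : F * F, lm.1 != 0 & x = basis_flag lm.
Proof.
case: x => v u xS a_neq0; rewrite /flag_act /=; set c := flag_cocycle _ _.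
move: xS; rewrite inE /= => /andP[v_neq0 /eqP vu] [va ua].
have szr (w : 'rV[F]_n.+2) : (size (rVpoly w) <= p)%N.
  exact: leq_trans (size_poly _ _) le_n_p.
have Pv : rVpoly v = ((rVpoly v)`_0)%:P.
  by apply: (shift_invariant_const a_neq0); rewrite ?szr // -rVpoly_translation va.
set l := (rVpoly v)`_0 in Pv.
have vE : v = l *: e0.
  apply: (can_inj rVpolyK); rewrite linearZ /= rVpoly_delta expr0 Pv.
  by rewrite alg_polyC.
have l_neq0 : l != 0 by apply: contraNneq v_neq0 => l0; rewrite vE l0 scale0r.
(* Since [u] goes to [u + c *: v] and [v] is the constant [l], subtracting the linear term of slope
   [m] leaves an invariant polynomial. *)
pose m := c * l / a.
pose Q := rVpoly u - m *: 'X.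
have uaE : rVpoly u \Po ('X + a%:P) = rVpoly u + (c * l)%:P.
  have uT : u *m translation n a = u + c *: v by rewrite -[X in X + _]ua va subrK.
  by rewrite -rVpoly_translation uT linearD linearZ /= Pv polyCM mul_polyC.
have QE : Q = (Q`_0)%:P.
  apply: (shift_invariant_const a_neq0).
    rewrite (leq_trans (size_polyD _ _)) // size_polyN geq_max szr.
    rewrite (leq_trans (size_scale_leq _ _)) // size_polyX.
    exact: leq_trans le_n_p.
  rewrite /Q comp_polyB uaE comp_polyZ comp_polyX scalerDr -!mul_polyC -polyCM.
  by rewrite mulfVK //; ring.
have uE : u = (Q`_0 / l) *: v + m *: e1.
  apply: (can_inj rVpolyK); rewrite linearD !linearZ /= rVpoly_delta expr1 Pv.
  by rewrite -mul_polyC -polyCM mulfVK // -QE subrK.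
exists (l, m) => //; rewrite /basis_flag /=; congr (_, _) => //.
(* The normalisation of [u] rules out a constant term. *)
move: vu; rewrite {1}uE ell_lin ell_self // {1}vE ell_e1 addr0 mulr1 => q0.
by rewrite uE q0 scale0r add0r.
Qed.

Lemma fixset_flags :
  fixset (flags F n) (@flag_act F n) (@translationGL F n) =
  basis_flag @: [set lm | lm.1 != 0].
Proof.
apply/setP => x; apply/setIdP/imsetP => [[xS /forallP fixx]|[lm]].
  have [lm lm1 ->] := translation_fixed xS (oner_neq0 _) (eqP (fixx 1)).
  by exists lm; rewrite ?inE.
rewrite inE => lm1 ->; split; first exact: basis_flagP.
by apply/forallP => a; rewrite flag_act_basis.
Qed.

Lemma fixset_translation x a : x \in flags F n ->
    flag_act x (translationGL n a) = x -> a != 0 ->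
  x \in fixset (flags F n) (@flag_act F n) (@translationGL F n).
Proof.
move=> xS ax a_neq0; have [lm lm1 ->] := translation_fixed xS a_neq0 ax.
by rewrite fixset_flags imset_f // inE.
Qed.

Lemma basis_flag_inj : injective basis_flag.
Proof.
case=> [l m] [l' m'] /= [/rowP/(_ 0) + /rowP/(_ 1)].
by rewrite !mxE !eqxx !mulr1 => -> ->.
Qed.

End FixedFlags.

(** * Nonvanishing *)

(** Each nonzero ratio has power 1 and the zero ratio has power 0, so the sum counts pairs of
    nonzero elements: (q - 1)^2 = 1 in [F]. *)
Lemma sum_ratios (F : finFieldType) p k : p \in [pchar F] -> (p %| #|F|)%N ->
    (0 < k)%N ->
  \sum_(lm in [set lm : F * F | lm.1 != 0]) (lm.2 / lm.1) ^+ (k * #|F|.-1) = 1.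
Proof.
move=> charFp pq k_gt0; have q_gt1 := finNzRing_gt1 F.
have pow1 (x : F) : x != 0 -> x ^+ (k * #|F|.-1) = 1.
  move=> x_neq0; rewrite mulnC exprM -[RHS](expr1n _ k); congr (_ ^+ _).
  by apply: (mulfI x_neq0); rewrite -exprS prednK ?expf_card ?mulr1 // ltnW.
have cardN0 : (\sum_(x : F | x != 0) 1 : F) = -1.
  rewrite sumr_const -(eq_card (in_set _)) cardsE.
  have -> : #|[pred x : F | x != 0]| = #|F|.-1 by rewrite (cardC1 0).
  apply/eqP; rewrite -subr_eq0 opprK -mulrSr prednK 1?ltnW //.
  by rewrite -(dvdn_pcharf charFp).
transitivity (\sum_(x : F | x != 0) \sum_(y : F | y != 0) (1 : F)); last first.
  by under eq_bigr do rewrite cardN0; rewrite sumrN cardN0 opprK.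
transitivity (\sum_(x : F | x != 0) \sum_(y : F) (y / x) ^+ (k * #|F|.-1)).
  by rewrite pair_big; apply: eq_bigl => lm; rewrite inE andbT.
apply: eq_bigr => x x_neq0; rewrite (bigD1 0) //= mul0r expr0n.
have /gtn_eqF-> : (0 < k * #|F|.-1)%N by rewrite muln_gt0 k_gt0 -subn1 subn_gt0.
rewrite add0r; apply: eq_bigr => y y_neq0.
by rewrite pow1 // mulf_neq0 ?invr_neq0.
Qed.

Theorem theorem1 (p r n : nat) (F : finFieldType)
    (hp : prime p) (hr : (1 <= r)%N) (hn : (2 <= n <= p)%N)
    (hF : #|F| = (p ^ r)%N) :
  cohomology {'GL_n[F]} 'F_p (r * (2 * p - 3))%N :!=: 1%g.
Proof.
have charFp : p \in [pchar F] by apply: card_finPcharP hF hp.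
have p_gt1 := prime_gt1 hp.
case: n hn => [|[|n]] // /andP[_ le_n_p].
pose js := iota 0 r; pose es := [seq j | j <- iota 0 r, k <- iota 0 (p - 2)].
have sz_es : size es = (r * (p - 2))%N by rewrite size_allpairs !size_iota.
have [xs szxs nz] : exists2 xs : seq F, size xs = size js &
    slant 1 p xs (size es) (omega p js es) != 0.
  apply: (@slant_omega _ _ charFp r); rewrite ?hF ?iota_uniq //.
  by apply/allP => j; rewrite mem_iota.
have [phi phi_nz] := exists_additive_neq0 charFp nz.
(* This rests on 1 + p(p - 2) = (p - 1)^2 and q - 1 = (p - 1)(1 + p + ... + p^(r-1)). *)
have weight : (\sum_(j <- js) p ^ j + \sum_(e <- es) p ^ e.+1)%N =
              ((p - 1) * #|F|.-1)%N.
  have inner i : (\sum_(k <- iota 0 (p - 2)) p ^ i.+1 = (p - 2) * p * p ^ i)%N.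
    have := sum_nat_const_nat 0 (p - 2) (p ^ i.+1).
    rewrite /index_iota subn0 => sE; rewrite -mulnA -expnS; exact: sE.
  rewrite big_allpairs_dep (eq_bigr _ (fun i _ => inner i)) -big_distrr /=.
  rewrite hF predn_exp -(big_mkord xpredT (fun i => p ^ i)%N) /index_iota subn0.
  move: (\sum_(_ <- _) _)%N => S.
  by case: (p) p_gt1 => [|[|p']] // _; rewrite !subSS subn0 /=; lia.
pose w (s : seq F) := phi (omega p js es s).
have wc t : bar_d +%R w t = 0.
  by rewrite /w -raddf_bar_d bar_d_omega // raddf0.
(* As r >= 1, [omega] starts with the factor x_0, which vanishes at 0. *)
have w0 k : w (nseq k 0) = 0.
  rewrite /w /js -(prednK hr); case: k => [|k] /=; first by rewrite raddf0.
  by rewrite expn0 expr1 mul0r raddf0.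
have [f fc fE] : exists2 f : seq {'GL_n.+2[F]} -> 'F_p,
    (forall s, bar_d (fun x y => x * y)%g f s = 0) &
    forall s, f (map (@translationGL F n) s) = w s.
  have [f fc fE] := exists_transfer (@flag_actS F n) (@flag_act_inj F n)
    (@flag_actM F n) (@flag_cocycleM F n) (@translationGLD F n)
    (@flag_act_translation0 F n) (fixset_translation charFp le_n_p) wc w0.
  exists f => // s; rewrite fE (fixset_flags charFp le_n_p).
  rewrite big_imset /=; last by move=> ? ? _ _; apply: basis_flag_inj.
  under eq_bigr => lm lm1.
    have -> : [seq flag_cocycle (basis_flag n lm) (translationGL n a) | a <- s] =
              [seq lm.2 / lm.1 * a | a <- s].
      apply: eq_map => a; apply: flag_cocycle_basis.
      by rewrite inE in lm1.
    rewrite /w omega_scale // weight.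
    over.
  rewrite -raddf_sum -mulr_suml (sum_ratios charFp) ?mul1r ?subn_gt0 //.
  by rewrite hF dvdn_exp.
have [m dE] : {m | (r * (2 * p - 3))%N = m.+1}.
  exists (r * (2 * p - 3)).-1; rewrite prednK // muln_gt0 hr; lia.
rewrite dE; apply: (cohomology_neq1 fc) => h fh.
case/eqP: phi_nz; rewrite raddf_slant -/w.
(* If the class on GL_n were the coboundary of [h], then [w] would be, in the relevant degree r +
   2r(p - 2), the coboundary of the restriction of [h] to the translations. *)
transitivity (slant 1 p xs (size es)
    (bar_d +%R (fun s => h (map (@translationGL F n) s)))).
  apply: eq_slant => s szs; rewrite -fE fh.
    by rewrite (bar_d_map _ _ (@translationGLD F n)).
  rewrite size_map szs -dE szxs size_iota sz_es -mul2n; nia.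
apply: slant_bar_d; first exact: prime_gt0.
  exact: pcharf0.
by rewrite pcharf0 ?pchar_Fp.
Qed.
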